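(* Let $f\in\mathcal A_c(\mathbb R^2)$. Let $\{g_n\}\subset\mathcal{HKBV}(\overline{\mathbb R}^2)$ be such that $\lVert g_n\rVert_{bv}$ is bounded and $\lim_{n\to\infty}g_n=g$ pointwise on $\overline{\mathbb R}^2$ for a function $g:\overline{\mathbb R}^2\to\mathbb R$. Then $g\in\mathcal{HKBV}(\overline{\mathbb R}^2)$ and $$\lim_{n\to\infty}\int_{-\infty}^\infty\int_{-\infty}^\infty fg_n=\int_{-\infty}^\infty\int_{-\infty}^\infty fg.$$
   Context: $\overline{\mathbb R}=[-\infty,\infty]$ is the two-point compactification of $\mathbb R$, and $\overline{\mathbb R}^2$ carries the product topology. $\mathcal B_c(\overline{\mathbb R}^2)$ is the set of continuous $F:\overline{\mathbb R}^2\to\mathbb R$ with $F(-\infty,s)=F(s,-\infty)=0$ for all $s\in\overline{\mathbb R}$. $\partial_{12}=\partial_1\partial_2$ is the distributional derivative on $\mathbb R^2$, and $\mathcal A_c(\mathbb R^2)=\{\partial_{12}F\mid F\in\mathcal B_c(\overline{\mathbb R}^2)\}\subset\mathcal D'(\mathbb R^2)$; the primitive $F$ of $f=\partial_{12}F$ is unique. Hardy--Krause variation: a division of $\overline{\mathbb R}^2$ is a finite collection of closed intervals with union $\overline{\mathbb R}^2$ whose pairwise intersections have planar Lebesgue measure zero. For $g:\overline{\mathbb R}^2\to\mathbb R$, $V_{12}g=\sup\sum_i|g(a_i,c_i)+g(b_i,d_i)-g(a_i,d_i)-g(b_i,c_i)|$ over all divisions $\{[a_i,b_i]\times[c_i,d_i]\}$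 of $\overline{\mathbb R}^2$; $V_1g(\cdot,y_0)$ and $V_2g(x_0,\cdot)$ are the one-variable total variations over $\overline{\mathbb R}$ of $x\mapsto g(x,y_0)$ and $y\mapsto g(x_0,y)$. $\mathcal{HKBV}(\overline{\mathbb R}^2)$ is the set of $g$ with $V_{12}g<\infty$ and, for some $x_0,y_0\in\overline{\mathbb R}$, $V_1g(\cdot,y_0)<\infty$ and $V_2g(x_0,\cdot)<\infty$. Here $\lVert V_1g\rVert_\infty=\sup_{y}V_1g(\cdot,y)$, $\lVert V_2g\rVert_\infty=\sup_xV_2g(x,\cdot)$, and $\lVert g\rVert_{bv}=\lVert g\rVert_\infty+\lVert V_1g\rVert_\infty+\lVert V_2g\rVert_\infty+V_{12}g$. Stieltjes integrals are Henstock--Stieltjes integrals: a gauge $\gamma$ assigns to each point an open set containing it (contained in $\mathbb R^2$ for points of $\mathbb R^2$); a tagged division $\{[a_i,b_i]\times[c_i,d_i],(x_i,y_i)\}$ (tag in its interval) is $\gamma$-fine if each interval is contained in $\gamma$ of its tag; $\iint F\,d_{12}g=A$ means for every $\epsilon>0$ there is a gauge $\gamma$ such that $|\sum_iF(x_i,y_i)[g(a_i,c_i)+g(b_i,d_i)-g(a_i,d_i)-g(b_i,c_i)]-A|<\epsilon$ for each $\gamma$-fine tagged division of the interval of integration. $d_1$ and $d_2$ denote the analogous one-variable integrals with respect to the first, resp. second, variable. The integral of the product $fg$ is defined by integration by parts: for $f\in\mathcal A_c(\mathbb R^2)$ with primitive $F$ and $g\in\mathcal{HKBV}(\overline{\mathbb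 R}^2)$, $\int_{-\infty}^\infty\int_{-\infty}^\infty fg:=F(\infty,\infty)g(\infty,\infty)-\int_{-\infty}^\infty F(s,\infty)\,d_1g(s,\infty)-\int_{-\infty}^\infty F(\infty,t)\,d_2g(\infty,t)+\int_{-\infty}^\infty\int_{-\infty}^\infty F\,d_{12}g$. *)

(* Defs.v *)
From HB Require Import structures.
From mathcomp Require Import all_boot all_order all_algebra.
From mathcomp Require Import all_classical all_reals all_analysis.

Set Implicit Arguments.
Unset Strict Implicit.
Unset Printing Implicit Defensive.

Import Order.TTheory GRing.Theory Num.Theory.
Import numFieldNormedType.Exports.

Local Open Scope classical_set_scope.
Local Open Scope ring_scope.

(* The compactification [-oo, +oo] is \bar R with its library topology, and
   functions of two variables are uncurried, so that [continuous] refers to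
   the product topology. *)

Section Distributions.
Variable R : realType.
Implicit Types phi psi : R * R -> R.

(* [false] is the first coordinate direction, [true] the second. *)
Definition dir (b : bool) : R * R := if b then (0, 1) else (1, 0).

Definition partial (b : bool) phi : R * R -> R := fun z => 'D_(dir b) phi z.

(* C^oo: every iterated partial derivative, taken in any order, is continuous
   and has first-order partial derivatives. *)
Definition smooth phi : Prop :=
  forall s : seq bool,
    continuous (foldr partial phi s) /\
    forall b z, derivable (foldr partial phi s) z (dir b).

Definition tsupport phi : set (R * R) := closure [set z | phi z != 0].

Record test_function := TestFunction {
  test_fun :> R * R -> R;
  test_smooth : smooth test_fun;
  test_compact : compact (tsupport test_fun) }.

Definition multi_partial (a b : nat) phi : R * R -> R :=
  iter a (partial false) (iter b (partial true) phi).

(* D'(R^2): linear functionals on test functions; continuity is expressed by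
   the usual estimate on every compact set, with the order [N] of the
   derivatives depending on the compact set. *)
Record schwartz_distribution := SchwartzDistribution {
  dist_fun :> test_function -> R;
  dist_linear : forall (a : R) (phi psi chi : test_function),
    (forall z, chi z = a * phi z + psi z) ->
    dist_fun chi = a * dist_fun phi + dist_fun psi;
  dist_continuous : forall K : set (R * R), compact K ->
    exists (C : R) (N : nat), forall phi : test_function,
      tsupport phi `<=` K ->
      `|dist_fun phi| <=
        C * \sum_(a < N.+1) \sum_(b < N.+1 | (a + b <= N)%N)
              sup (range (fun z => `|multi_partial a b phi z|)) }.

Definition emb2 (z : R * R) : \bar R * \bar R := (z.1%:E, z.2%:E).

Definition Bc (F : \bar R * \bar R -> R) : Prop :=
  continuous F /\ forall s : \bar R, F (-oo%E, s) = 0 /\ F (s, -oo%E) = 0.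

(* f = d_1 d_2 F in D'(R^2); the two signs from moving the derivatives onto
   the test function cancel. *)
Definition is_d12 (F : \bar R * \bar R -> R) (f : schwartz_distribution) : Prop :=
  forall phi : test_function,
    f phi = \int[(lebesgue_measure \x lebesgue_measure)%E]_z
      (F (emb2 z) * partial true (partial false phi) z).

Definition Ac (f : schwartz_distribution) : Prop := exists F, Bc F /\ is_d12 F f.

(* The primitive of f in Ac is unique; [xget] selects it. *)
Definition primitive (f : schwartz_distribution) : \bar R * \bar R -> R :=
  xget (cst 0) [set F | Bc F /\ is_d12 F f].

End Distributions.

Section Divisions.
Variable R : realType.

(* The pair (a, b) stands for [a, b], and ((a, b), (c, d)) for
   [a, b] x [c, d]; intervals are nondegenerate. *)
Definition bnd1 : Type := (\bar R * \bar R)%type.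
Definition bnd2 : Type := (bnd1 * bnd1)%type.

Definition cell1 (I : bnd1) : set (\bar R) := [set x | (I.1 <= x <= I.2)%E].
Definition cell2 (I : bnd2) : set (\bar R * \bar R) := cell1 I.1 `*` cell1 I.2.

(* Lebesgue measure only sees the finite points of the intersections. *)
Definition division1 (n : nat) (I : 'I_n -> bnd1) : Prop :=
  [/\ forall i, ((I i).1 < (I i).2)%E,
      \bigcup_i cell1 (I i) = setT &
      forall i j, i != j ->
        lebesgue_measure ((@EFin R) @^-1` (cell1 (I i) `&` cell1 (I j))) = 0%E].

Definition division2 (n : nat) (I : 'I_n -> bnd2) : Prop :=
  [/\ forall i, ((I i).1.1 < (I i).1.2)%E /\ ((I i).2.1 < (I i).2.2)%E,
      \bigcup_i cell2 (I i) = setT &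
      forall i j, i != j ->
        (lebesgue_measure \x lebesgue_measure)%E
          (@emb2 R @^-1` (cell2 (I i) `&` cell2 (I j))) = 0%E].

Definition incr1 (h : \bar R -> R) (I : bnd1) : R := h I.2 - h I.1.

Definition incr2 (g : \bar R * \bar R -> R) (I : bnd2) : R :=
  g (I.1.1, I.2.1) + g (I.1.2, I.2.2) - g (I.1.1, I.2.2) - g (I.1.2, I.2.1).

End Divisions.

Section Variation.
Variable R : realType.
Implicit Types (h : \bar R -> R) (g : \bar R * \bar R -> R).
Local Open Scope ereal_scope.

Definition variation1 h : \bar R :=
  ereal_sup [set v | exists (n : nat) (I : 'I_n -> bnd1 R),
    division1 I /\ v = (\sum_(i < n) `|incr1 h (I i)|)%R%:E].

Definition V12 g : \bar R :=
  ereal_sup [set v | exists (n : nat) (I : 'I_n -> bnd2 R),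
    division2 I /\ v = (\sum_(i < n) `|incr2 g (I i)|)%R%:E].

Definition V1 g (y : \bar R) : \bar R := variation1 (fun x => g (x, y)).
Definition V2 g (x : \bar R) : \bar R := variation1 (fun y => g (x, y)).

Definition HKBV g : Prop :=
  V12 g < +oo /\ exists x0 y0 : \bar R, V1 g y0 < +oo /\ V2 g x0 < +oo.

Definition bvnorm g : \bar R :=
  ereal_sup (range (fun z => `|g z|%R%:E)) +
  ereal_sup (range (V1 g)) + ereal_sup (range (V2 g)) + V12 g.

End Variation.

Section HenstockStieltjes.
Variable R : realType.

Definition gauge1 (gam : \bar R -> set (\bar R)) : Prop :=
  (forall x, open (gam x) /\ gam x x) /\
  (forall x : R, gam x%:E `<=` range (@EFin R)).

Definition gauge2 (gam : \bar R * \bar R -> set (\bar R * \bar R)) : Prop :=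
  (forall z, open (gam z) /\ gam z z) /\
  (forall z : R * R, gam (emb2 z) `<=` range (@emb2 R)).

Definition is_HSint1 (F g : \bar R -> R) (A : R) : Prop :=
  forall e : R, 0 < e -> exists gam, gauge1 gam /\
    forall (n : nat) (I : 'I_n -> bnd1 R) (t : 'I_n -> \bar R),
      division1 I ->
      (forall i, cell1 (I i) (t i)) ->
      (forall i, cell1 (I i) `<=` gam (t i)) ->
      `|\sum_(i < n) F (t i) * incr1 g (I i) - A| < e.

Definition is_HSint2 (F g : \bar R * \bar R -> R) (A : R) : Prop :=
  forall e : R, 0 < e -> exists gam, gauge2 gam /\
    forall (n : nat) (I : 'I_n -> bnd2 R) (t : 'I_n -> \bar R * \bar R),
      division2 I ->
      (forall i, cell2 (I i) (t i)) ->
      (forall i, cell2 (I i) `<=` gam (t i)) ->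
      `|\sum_(i < n) F (t i) * incr2 g (I i) - A| < e.

(* The value of the integral, or 0 if it does not exist. *)
Definition HSint1 (F g : \bar R -> R) : R := xget 0 [set A | is_HSint1 F g A].
Definition HSint2 (F g : \bar R * \bar R -> R) : R :=
  xget 0 [set A | is_HSint2 F g A].

Definition int_prod (f : schwartz_distribution R) (g : \bar R * \bar R -> R) : R :=
  let F := primitive f in
  F (+oo%E, +oo%E) * g (+oo%E, +oo%E)
  - HSint1 (fun s => F (s, +oo%E)) (fun s => g (s, +oo%E))
  - HSint1 (fun t => F (+oo%E, t)) (fun t => g (+oo%E, t))
  + HSint2 F g.

End HenstockStieltjes.

(* Main.v *)
Require Import Defs.
From mathcomp Require Import all_boot all_order all_algebra.
From mathcomp Require Import all_classical all_reals all_analysis.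
From mathcomp Require Import ring lra.

Set Implicit Arguments.
Unset Strict Implicit.
Unset Printing Implicit Defensive.

Import Order.TTheory GRing.Theory Num.Theory.
Import numFieldNormedType.Exports.

Local Open Scope classical_set_scope.
Local Open Scope ring_scope.

(** The primitive [F] of [f] is continuous on the compactified plane.  Given
    [e > 0], let the neighbourhood [osc F e z] of [z] consist of the points
    where [F] differs from [F z] by less than [e].  If two tagged
    divisions are fine for these neighbourhoods, then on each box of a common
    refinement the two tags give values of [F] at distance less than [2 e], so
    the two Riemann-Stieltjes sums differ by at most [2 e V(g)]
    ([riemann_sum_near]).  Hence the integral of [F] against [g] exists
    ([stieltjes_exists]), and every fine sum approximates it within [2 e V(g)]
    ([riemann_sum_stieltjes]).

    The neighbourhoods do not depend on the integrator.  So a single division,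
    fine for [osc F e], approximates the integrals against all [g_n] and against
    [g] with an error that is uniform because the variations are bounded.  For
    this division the sums converge by pointwise convergence of [g_n], being
    finite.  This proves the convergence of the integrals ([stieltjes_cvg]).
    The variation of the limit is controlled in the same way: it is a supremum
    of finite sums, each of which passes to the limit ([box_variation_lsc]).

    The argument is the same on the line and in the plane, and it needs two
    facts about divisions.  Two divisions have a common refinement over whose
    boxes the increments add up ([refinement1], [refinement2]): cut along the
    grid of all endpoints.  And a fine division exists for every system of
    neighbourhoods, which is Cousin's lemma ([cousin1], [cousin2]).  The latter
    also makes integrals meaningful: two conditions, each given by a gauge, can
    be met by one division.

    The integral of [f g_n] is a point value plus two integrals on the line and
    one in the plane, each of which converges. *)

(** * Stieltjes integrals of continuous functions over abstract boxes *)

(** [B] is a type of boxes in the space [X]; the intervals and rectangles of the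
    compactified line and plane are the two cases of interest. *)
Section AbstractIntegral.
Variables (R : realType) (X : topologicalType) (B : Type).
Variables (cell : B -> set X) (division : forall n, ('I_n -> B) -> Prop).
Variables (incr : (X -> R) -> B -> R) (gauge : (X -> set X) -> Prop).
Implicit Types (F g : X -> R).

Definition gauge_fine (gam : X -> set X) n
    (I : 'I_n -> B) (t : 'I_n -> X) : Prop :=
  [/\ division I, forall i, cell (I i) (t i) &
      forall i, cell (I i) `<=` gam (t i)].

Definition riemann_sum F g n (I : 'I_n -> B) (t : 'I_n -> X) : R :=
  \sum_(i < n) F (t i) * incr g (I i).

Definition box_variation g : \bar R :=
  ereal_sup [set v | exists (n : nat) (I : 'I_n -> B),
    division I /\ v = (\sum_(i < n) `|incr g (I i)|)%R%:E].

(** Stated without [gauge_fine] so that [is_HSint1] and [is_HSint2] are instances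
    by conversion. *)
Definition is_stieltjes F g (A : R) : Prop :=
  forall e : R, 0 < e -> exists gam, gauge gam /\
    forall (n : nat) (I : 'I_n -> B) (t : 'I_n -> X),
      division I ->
      (forall i, cell (I i) (t i)) ->
      (forall i, cell (I i) `<=` gam (t i)) ->
      `|riemann_sum F g I t - A| < e.

Definition stieltjes F g : R := xget 0 [set A | is_stieltjes F g A].

(** Gauges and systems of neighbourhoods are interchangeable: the next two
    hypotheses allow every construction to be made with neighbourhoods alone,
    whatever additional constraint a gauge has to satisfy. *)
Hypothesis gauge_nbhs : forall gam, gauge gam -> forall x, nbhs x (gam x).
Hypothesis gauge_shrink : forall N : X -> set X,
  (forall x, nbhs x (N x)) ->
  exists gam, gauge gam /\ forall x, gam x `<=` N x.
Hypothesis cousin : forall N : X -> set X,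
  (forall x, nbhs x (N x)) ->
  exists n (I : 'I_n -> B) (t : 'I_n -> X), gauge_fine N I t.
(** Box [K k] of the refinement lies in box [a k] of the first division and in
    box [b k] of the second one.  Of this inclusion only two consequences are
    retained: these boxes share a point, and increments add up. *)
Hypothesis refinement : forall n (I : 'I_n -> B) m (J : 'I_m -> B),
  division I -> division J ->
  exists p (K : 'I_p -> B) (a : 'I_p -> 'I_n) (b : 'I_p -> 'I_m),
  [/\ division K,
      forall k, cell (I (a k)) `&` cell (J (b k)) !=set0,
      forall g i, incr g (I i) = \sum_(k | a k == i) incr g (K k) &
      forall g j, incr g (J j) = \sum_(k | b k == j) incr g (K k)].
Hypothesis incr_cvg : forall (gn : nat -> X -> R) g b,
  (forall z, (fun n => gn n z) @ \oo --> g z) ->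
  (fun n => incr (gn n) b) @ \oo --> incr g b.

Definition osc F (e : R) (x : X) : set X := [set y | `|F x - F y| < e].

Lemma osc_nbhs F e : continuous F -> 0 < e -> forall x, nbhs x (osc F e x).
Proof. by move=> Fc e0 x; have /cvgrPdist_lt := Fc x; apply. Qed.

Lemma box_variation_le g (M : R) n (I : 'I_n -> B) :
  (box_variation g <= M%:E)%E -> division I ->
  \sum_(i < n) `|incr g (I i)| <= M.
Proof.
move=> gM dI; rewrite -lee_fin; apply: le_trans gM.
by apply: ereal_sup_ubound; exists n, I.
Qed.

(** [phi] is the absolute value for variations and the multiplication by
    [F (t i)] for Riemann sums. *)
Lemma sum_incr_cvg (gn : nat -> X -> R) g n (I : 'I_n -> B)
    (phi : 'I_n -> R -> R) :
  (forall z, (fun k => gn k z) @ \oo --> g z) ->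
  (forall i, continuous (phi i)) ->
  (fun k => \sum_(i < n) phi i (incr (gn k) (I i))) @ \oo -->
  \sum_(i < n) phi i (incr g (I i)).
Proof.
move=> gng phic; apply: (@cvg_big R _ +%R 0 predT (@add_continuous R) _ _ _
  (fun i k => phi i (incr (gn k) (I i)))) => i _.
exact: (cvg_comp _ _ (incr_cvg gng) (phic i _)).
Qed.

Lemma box_variation_lsc (gn : nat -> X -> R) g (M : R) :
  (forall z, (fun k => gn k z) @ \oo --> g z) ->
  (forall k, (box_variation (gn k) <= M%:E)%E) -> (box_variation g <= M%:E)%E.
Proof.
move=> gng gM; apply: ge_ereal_sup => _ [n [I [dI ->]]]; rewrite lee_fin.
apply: (@cvgr_to_le _ \oo _ _ (fun k => \sum_(i < n) `|incr (gn k) (I i)|)).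
  apply: (sum_incr_cvg (gn := gn) (g := g) (I := I)
    (phi := fun=> Num.norm)) => // _ x.
  exact: norm_continuous.
by near=> k; apply: box_variation_le.
Unshelve. all: by end_near. Qed.

(** Both sums are rewritten over the common refinement, where the coefficients
    of each increment are values of [F] at points that are close, within [e] and
    [d], to a common point of the two boxes. *)
Lemma riemann_sum_near F g (M e d : R) n (I : 'I_n -> B) t m (J : 'I_m -> B) u :
  0 < e -> 0 < d -> (box_variation g <= M%:E)%E ->
  gauge_fine (osc F e) I t -> gauge_fine (osc F d) J u ->
  `|riemann_sum F g I t - riemann_sum F g J u| <= (e + d) * M.
Proof.
move=> e0 d0 gM [dI It Ie] [dJ Ju Jd].
have [p [K [a [b [dK ab Ia Jb]]]]] := refinement dI dJ.
have sumE q (f : 'I_q -> R) L (c : 'I_p -> 'I_q) :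
    (forall g i, incr g (L i) = \sum_(k | c k == i) incr g (K k)) ->
    \sum_i f i * incr g (L i) = \sum_k f (c k) * incr g (K k).
  move=> Lc; rewrite (partition_big c predT)//=; apply: eq_bigr => i _.
  by rewrite Lc big_distrr/=; apply: eq_bigr => k /eqP ->.
rewrite /riemann_sum (sumE _ (F \o t) I a)// (sumE _ (F \o u) J b)//= -sumrB.
apply: (le_trans (ler_norm_sum _ _ _)).
apply: (@le_trans _ _ (\sum_k (e + d) * `|incr g (K k)|)).
  apply: ler_sum => k _; rewrite -mulrBl normrM ler_wpM2r//.
  have [z [Iz Jz]] := ab k.
  have := Ie _ _ Iz; have := Jd _ _ Jz; rewrite /osc/= => ? ?.
  rewrite (_ : _ - _ = (F (t (a k)) - F z) - (F (u (b k)) - F z)); last by ring.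
  by apply: (le_trans (ler_normB _ _)); apply: lerD; exact: ltW.
rewrite -mulr_sumr ler_wpM2l//; first by rewrite addr_ge0// ltW.
exact: box_variation_le dK.
Qed.

(** The sums over divisions that are fine for [osc F (1 / k.+1)] form a Cauchy
    sequence, whose limit is the integral. *)
Lemma stieltjes_exists F g (M : R) : continuous F ->
  (box_variation g <= M%:E)%E -> exists A, is_stieltjes F g A.
Proof.
move=> Fc gM.
pose N k := osc F k.+1%:R^-1.
have e0 k : 0 < k.+1%:R^-1 :> R by rewrite invr_gt0.
have /choice[P Pf] : forall k,
    exists P : {n & (('I_n -> B) * ('I_n -> X))%type},
    gauge_fine (N k) (projT2 P).1 (projT2 P).2.
  move=> k; have [n [I [t It]]] := cousin (osc_nbhs Fc (e0 k)).
  by exists (existT _ n (I, t)).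
pose S k := riemann_sum F g (projT2 (P k)).1 (projT2 (P k)).2.
have SB k l : `|S k - S l| <= (k.+1%:R^-1 + l.+1%:R^-1) * M.
  exact: (riemann_sum_near (e0 k) (e0 l) gM (Pf k) (Pf l)).
have M0 : 0 <= M.
  have := SB 0%N 0%N; rewrite subrr normr0 pmulr_rge0//.
(* M + 1 replaces M, which may vanish, as a divisor *)
have small (e : R) : 0 < e -> \forall k \near \oo, k.+1%:R^-1 * (M + 1) < e.
  move=> e_gt0; have M1 : 0 < M + 1 by lra.
  near=> k; rewrite -ltr_pdivlMr//; near: k.
  by apply: (near_infty_natSinv_lt (PosNum (divr_gt0 e_gt0 M1))).
have Scvg : cvgn S.
  apply/cauchy_cvgP/cauchy_exP => e e_gt0.
  have e2 : 0 < e / 2 by lra.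
  have [k kM] := filter_ex (small _ e2).
  exists (S k); suff: \forall l \near \oo, ball (S k) e (S l) by [].
  near=> l; suff lt_e : `|S k - S l| < e by rewrite -ball_normE.
  apply: (le_lt_trans (SB k l)).
  have : l.+1%:R^-1 * (M + 1) < e / 2 by near: l; exact: small.
  move: kM (e0 k) (e0 l); move: (k.+1%:R^-1) (l.+1%:R^-1) => a b; nra.
have [A SA] : exists A : R, S @ \oo --> A by exists (limn S).
exists A => e e_gt0.
have e3 : 0 < e / 3 by lra.
have [k [Sk kM]] : exists k, `|S k - A| < e / 3 /\ k.+1%:R^-1 * (M + 1) < e / 3.
  suff : \forall k \near \oo,
      `|S k - A| < e / 3 /\ k.+1%:R^-1 * (M + 1) < e / 3.
    by case/filter_ex => k; exists k.
  apply: filterI; last exact: small.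
  by near do rewrite distrC; move/cvgrPdist_lt : SA; apply.
have [gam [gg gN]] := gauge_shrink (osc_nbhs Fc (e0 k)).
exists gam; split => // n I t dI It Igam.
have If : gauge_fine (N k) I t by split => // i z /Igam /gN.
have := riemann_sum_near (e0 k) (e0 k) gM If (Pf k).
rewrite -/(S k) => SS.
rewrite (_ : _ - A = (riemann_sum F g I t - S k) + (S k - A)); last by ring.
apply: (le_lt_trans (ler_normD _ _)).
move: kM Sk SS (e0 k); move: (k.+1%:R^-1) => a; nra.
Unshelve. all: by end_near. Qed.

(** The error of a fine sum is explicit, and the fineness that it requires is
    independent of [g].  The proof compares with a division that is fine both
    for [osc F e] and for a gauge that witnesses the integral to a precision
    [d], which is arbitrary. *)
Lemma riemann_sum_stieltjes F g (M e : R) n (I : 'I_n -> B) t : continuous F ->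
  (box_variation g <= M%:E)%E -> 0 < e -> gauge_fine (osc F e) I t ->
  `|riemann_sum F g I t - stieltjes F g| <= (e + e) * M.
Proof.
move=> Fc gM e0 If; apply/ler_addgt0Pr => d d0.
have /xgetPex : exists A, [set A | is_stieltjes F g A] A.
  exact: stieltjes_exists gM.
move=> /(_ 0 d d0)[gam [gg gamP]].
have [m [J [u [dJ Ju Jgam]]]] : exists m (J : 'I_m -> B) u,
    gauge_fine (fun x => gam x `&` osc F e x) J u.
  by apply/cousin => x; apply: filterI; [exact: gauge_nbhs|exact: osc_nbhs].
have Jf : gauge_fine (osc F e) J u by split => // i z /Jgam[].
have := riemann_sum_near e0 e0 gM If Jf.
have /ltW : `|riemann_sum F g J u - stieltjes F g| < d.
  by apply: gamP => // i z /Jgam[].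
move=> A1 A2; apply: (le_trans (ler_distD (riemann_sum F g J u) _ _)).
exact: lerD.
Qed.

(** One division serves all the integrators at once. *)
Lemma stieltjes_cvg F (gn : nat -> X -> R) g (M : R) : continuous F ->
  (forall k, (box_variation (gn k) <= M%:E)%E) ->
  (forall z, (fun k => gn k z) @ \oo --> g z) ->
  (fun k => stieltjes F (gn k)) @ \oo --> stieltjes F g.
Proof.
move=> Fc gnM gng; have gM := box_variation_lsc gng gnM.
apply/cvgrPdist_lt => e e_gt0.
(* 2 d M <= 2 e / 5 bounds the error of the sum for [g] and for [gn k]; the two
   sums differ by e / 5 *)
pose d := e / (5 * (`|M| + 1)).
have M1 : 0 < 5 * (`|M| + 1) by have := normr_ge0 M; lra.
have d0 : 0 < d by rewrite divr_gt0.
have [n [I [t It]]] := cousin (osc_nbhs Fc d0).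
have dM : (d + d) * M <= 2 * (e / 5).
  have -> : (d + d) * M = 2 * (e / 5) * (M / (`|M| + 1)).
    by rewrite /d; field; have := normr_ge0 M; lra.
  rewrite ler_piMr//; first by lra.
  by rewrite ler_pdivrMr; have := normr_ge0 M; have := ler_norm M; lra.
have Scvg : (fun k => riemann_sum F (gn k) I t) @ \oo --> riemann_sum F g I t.
  apply: (sum_incr_cvg (phi := fun i => *%R (F (t i))) gng) => i.
  exact: mulrl_continuous.
have e5 : 0 < e / 5 by lra.
near=> k.
have Sk : `|riemann_sum F g I t - riemann_sum F (gn k) I t| < e / 5.
  by near: k; move/cvgrPdist_lt : Scvg; apply.
have := riemann_sum_stieltjes Fc gM d0 It.
have := riemann_sum_stieltjes Fc (gnM k) d0 It.
move: Sk; rewrite !ltr_norml !ler_norml => /andP[? ?] /andP[? ?] /andP[? ?].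
apply/andP; lra.
Unshelve. all: by end_near. Qed.
End AbstractIntegral.

(** * Divisions as order-theoretic tilings *)

Section Tilings.
Variable R : realType.
Implicit Types (x y z : \bar R) (I J : bnd1 R).

Lemma ereal_between x y : (x < y)%E -> exists z, (x < z < y)%E.
Proof.
case: x => [r||]; case: y => [s||]//.
- rewrite lte_fin => rs; exists ((r + s) / 2)%:E; rewrite !lte_fin.
  by apply/andP; split; lra.
- by move=> _; exists (r + 1)%:E; rewrite ltry lte_fin andbT; lra.
- by move=> _; exists (s - 1)%:E; rewrite ltNyr lte_fin; lra.
- by move=> _; exists 0%E; rewrite ltry ltNyr.
Qed.

(** Only finite points are measured, but a nondegenerate interval of the
    extended line contains a nondegenerate interval of reals. *)
Lemma lebesgue_cell1 x y :
  lebesgue_measure ((@EFin R) @^-1` cell1 (x, y)) = 0%E <-> (y <= x)%E.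
Proof.
(* an end of the cell at infinity imposes no bound or excludes all reals *)
have -> : (@EFin R) @^-1` cell1 (x, y) =
    [set` Interval (if x is r%:E then BLeft r else
                    BInfty _ (x == -oo%E))
                   (if y is s%:E then BRight s else
                    BInfty _ (y == -oo%E))].
  apply/seteqP; split=> r; rewrite /cell1/= in_itv/=;
  by case: x => [u||]; case: y => [v||];
    rewrite ?lee_fin ?leey ?leNye ?leeNy_eq ?leye_eq ?andbT ?andbF ?eqxx//=.
rewrite lebesgue_measure_itv.
case: x => [u||]; case: y => [v||]//=;
  rewrite ?lee_fin ?leey ?leNye ?ltey ?ltNye ?lteNy ?leeNy_eq ?leye_eq//=.
all: try by split.
all: case: ifP; try by split.
- rewrite lte_fin -EFinD => uv.
  by split=> [[]|]; [lra|rewrite leNgt uv].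
- by rewrite lte_fin => uv; split => // _; rewrite leNgt uv.
Qed.

Lemma measurable_cell1 I : measurable ((@EFin R) @^-1` cell1 I).
Proof.
have -> : cell1 I = [set` `[I.1, I.2]].
  by apply/seteqP; split=> x; rewrite /cell1/= in_itv.
rewrite -[X in measurable X]setTI.
apply: measurable_realfun.EFin_measurable => //.
exact: measurable_realfun.emeasurable_itv.
Qed.

(** The larger left end is not below the smaller right end. *)
Definition apart I J : Prop := (Order.min I.2 J.2 <= Order.max I.1 J.1)%E.

Lemma cell1I I J :
  cell1 I `&` cell1 J = cell1 (Order.max I.1 J.1, Order.min I.2 J.2).
Proof.
apply/seteqP; split=> x; rewrite /cell1/= ge_max le_min.
  by case=> /andP[-> ->] /andP[-> ->].
by case/andP => /andP[-> ->] /andP[-> ->].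
Qed.

Lemma apartP I J : lebesgue_measure
  ((@EFin R) @^-1` (cell1 I `&` cell1 J)) = 0%E <-> apart I J.
Proof. by rewrite cell1I lebesgue_cell1. Qed.

Lemma apart2P (I J : bnd2 R) : (lebesgue_measure \x lebesgue_measure)%E
    (@emb2 R @^-1` (cell2 I `&` cell2 J)) = 0%E <->
  apart I.1 J.1 \/ apart I.2 J.2.
Proof.
have -> : @emb2 R @^-1` (cell2 I `&` cell2 J) =
    ((@EFin R) @^-1` (cell1 I.1 `&` cell1 J.1)) `*`
    ((@EFin R) @^-1` (cell1 I.2 `&` cell1 J.2)).
  by apply/seteqP; split=> z /=; rewrite /cell2/=; tauto.
rewrite product_measure1E; last 2 first.
- by rewrite cell1I; exact: measurable_cell1.
- by rewrite cell1I; exact: measurable_cell1.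
split => [/eqP|].
  by rewrite mule_eq0 => /orP[] /eqP/apartP; tauto.
by case=> /apartP IJ0; apply/eqP; rewrite mule_eq0; apply/orP;
  [left|right]; exact/eqP.
Qed.

(** Divisions with measure-zero overlaps expressed by the order alone.  The
    index type is an arbitrary finite type, so that products and dependent sums
    can index tilings of the plane. *)
Definition tiling1 (T : finType) (I : T -> bnd1 R) : Prop :=
  [/\ forall i, ((I i).1 < (I i).2)%E,
      forall x, exists i, cell1 (I i) x &
      forall i j, i != j -> apart (I i) (I j)].

Definition tiling2 (T : finType) (I : T -> bnd2 R) : Prop :=
  [/\ forall i, ((I i).1.1 < (I i).1.2)%E /\ ((I i).2.1 < (I i).2.2)%E,
      forall z : \bar R * \bar R, exists i, cell2 (I i) z &
      forall i j, i != j -> apart (I i).1 (I j).1 \/ apart (I i).2 (I j).2].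

Lemma division1P n (I : 'I_n -> bnd1 R) : division1 I <-> tiling1 I.
Proof.
split=> -[I0 Ic Ia]; split.
- exact: I0.
- move=> x; have [i _ Ix] : (\bigcup_i cell1 (I i)) x by rewrite Ic.
  by exists i.
- by move=> i j ij; apply/apartP; apply: Ia.
- exact: I0.
- apply/seteqP; split; first exact: subsetT.
  by move=> x _; have [i Ix] := Ic x; exists i.
- by move=> i j ij; apply/apartP; apply: Ia.
Qed.

Lemma division2P n (I : 'I_n -> bnd2 R) : division2 I <-> tiling2 I.
Proof.
split=> -[I0 Ic Ia]; split.
- exact: I0.
- move=> x; have [i _ Ix] : (\bigcup_i cell2 (I i)) x by rewrite Ic.
  by exists i.
- by move=> i j ij; apply/apart2P; apply: Ia.
- exact: I0.
- apply/seteqP; split; first exact: subsetT.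
  by move=> x _; have [i Ix] := Ic x; exists i.
- by move=> i j ij; apply/apart2P; apply: Ia.
Qed.

Lemma tiling2_division (T : finType) (I : T -> bnd2 R) :
  tiling2 I -> division2 (I \o @enum_val T predT).
Proof.
case=> I0 Ic Ia; apply/division2P; split=> [i|z|i j ij]; first exact: I0.
  by have [i Iz] := Ic z; exists (enum_rank i); rewrite /= enum_rankK.
by apply: Ia; apply: contra_neq ij => /enum_val_inj.
Qed.

End Tilings.

(** * Grids *)

Section Grids.
Variable R : realType.
Implicit Types (x y : \bar R) (I J : bnd1 R).

Definition grid_cell (u : nat -> \bar R) (k : nat) : bnd1 R := (u k, u k.+1).

(** The [m] cells cover the extended line; [u] is arbitrary beyond [m]. *)
Definition grid (m : nat) (u : nat -> \bar R) : Prop :=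
  [/\ u 0%N = -oo%E, u m = +oo%E & forall k, (k < m)%N -> (u k < u k.+1)%E].

Lemma grid_lt m u k l : grid m u -> (k < l <= m)%N -> (u k < u l)%E.
Proof.
case=> _ _ um; elim: l => // l IH /andP[]; rewrite ltnS leq_eqVlt.
case/predU1P => [->|kl] lm; first exact: um.
by apply: lt_trans (um _ lm); apply: IH; rewrite kl ltnW.
Qed.

Lemma grid_leE m u k l : grid m u -> (k <= m)%N -> (l <= m)%N ->
  (u k <= u l)%E = (k <= l)%N.
Proof.
move=> gu km lm; case: (ltngtP k l) => [kl|lk|->]; last exact: lexx.
  by apply/ltW/(grid_lt gu) => //; rewrite kl.
by apply/negbTE; rewrite -ltNge; apply: (grid_lt gu) => //; rewrite lk.
Qed.

Lemma grid_cover m u x : grid m u -> exists k : 'I_m, cell1 (grid_cell u k) x.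
Proof.
move=> [u0 um uS].
have [k] : exists k, (k < m)%N /\ (u k <= x <= u k.+1)%E.
  have : exists k, (x <= u k)%E by exists m; rewrite um leey.
  case/ex_minnP => -[|k] xk kmin.
    have xN : x = -oo%E by apply/eqP; rewrite -leeNy_eq -u0.
    (* the first cell is proper because u 0 and u m are distinct *)
    exists 0%N; rewrite xN u0 lexx leNye; split=> //.
    by case: (m) um => //; rewrite u0.
  exists k; split; first by apply: kmin; rewrite um leey.
  by rewrite xk andbT leNgt; apply/negP => /ltW /kmin; rewrite ltnn.
by case=> km xk; exists (Ordinal km).
Qed.

Lemma grid_tiling m u : grid m u -> tiling1 (fun k : 'I_m => grid_cell u k).
Proof.
move=> gu; split=> [k|x|k l]; first by case: gu => _ _; apply.
  exact: grid_cover.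
rewrite /apart/=; wlog kl : k l / (k < l)%N.
  move=> W; rewrite neq_ltn => /orP[kl|lk].
    by apply: W; rewrite // neq_ltn kl.
  by rewrite minC maxC; apply: W; rewrite // neq_ltn lk.
move=> _; rewrite ge_min le_max.
have lm := ltn_ord l.
by rewrite (grid_leE (k := k.+1) (l := l) gu)// ?kl ?orbT// ltnW.
Qed.

(** Sort the points, together with the two infinite ones. *)
Lemma exists_grid (s : seq (\bar R)) : exists m u, grid m u /\
  forall x, x \in s -> exists2 k, (k <= m)%N & u k = x.
Proof.
pose r := sort <=%O (undup [:: -oo%E, +oo%E & s]).
pose u := nth +oo%E r.
have mem_r x : (x \in r) = (x \in [:: -oo%E, +oo%E & s]).
  by rewrite mem_sort mem_undup.
have r_lt : sorted <%O r by rewrite sort_lt_sorted undup_uniq.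
have r_le : sorted <=%O r by rewrite sort_le_sorted.
have r0 : (0 < size r)%N.
  by case: (r) (mem_r -oo%E); rewrite //= inE eqxx.
have rS : (size r).-1.+1 = size r by rewrite prednK.
have u_le k l : (k <= l)%N -> (l < size r)%N -> (u k <= u l)%E.
  move=> kl lr.
  apply: (sorted_leq_nth le_trans le_refl +oo%E r_le) => //; rewrite inE //.
  exact: leq_ltn_trans lr.
exists (size r).-1, u; split.
  split.
  - have : -oo%E \in r by rewrite mem_r inE eqxx.
    move=> /(nthP +oo%E)[k kr uk]; apply/eqP; rewrite -leeNy_eq -uk.
    exact: u_le.
  - have : +oo%E \in r by rewrite mem_r !inE eqxx orbT.
    move=> /(nthP +oo%E)[k kr uk]; apply/eqP; rewrite -leye_eq -uk.
    by apply: u_le; [rewrite -ltnS rS|rewrite rS].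
  - move=> k; rewrite -ltnS rS => kr.
    apply: (sorted_ltn_nth lt_trans +oo%E r_lt); rewrite ?inE//.
    exact: ltn_trans kr.
move=> x xs; have : x \in r by rewrite mem_r !inE xs !orbT.
by move=> /(nthP +oo%E)[k kr uk]; exists k; rewrite // -ltnS rS.
Qed.

Definition on_grid m (u : nat -> \bar R) I : Prop :=
  (exists2 p, (p <= m)%N & u p = I.1) /\ (exists2 q, (q <= m)%N & u q = I.2).

Definition subitv I J : bool := ((J.1 <= I.1) && (I.2 <= J.2))%E.

(** The cells inside an interval whose ends are grid points are consecutive, and
    the sum of the increments over them telescopes. *)
Lemma grid_telescope m u I h : grid m u -> (I.1 < I.2)%E ->
  on_grid m u I ->
  incr1 h I = \sum_(k < m | subitv (grid_cell u k) I) incr1 h (grid_cell u k).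
Proof.
case: I => a b gu /= ab [[p pm /= pa] [q qm /= qb]]; subst a b.
have pq : (p <= q)%N by rewrite -(grid_leE gu)// ltW.
rewrite (eq_bigl (fun k : 'I_m => (p <= k)%N && (k < q)%N)); last first.
  by move=> k; rewrite /subitv/= !(grid_leE gu) // ltnW.
rewrite -(big_ord_widen_cond m (fun k => p <= k)%N
  (fun k => incr1 h (grid_cell u k)))//.
rewrite (eq_bigl (fun k : 'I_q => xpredT (k : nat) && (p <= k)%N))//.
rewrite -(big_geq_mkord p q xpredT (fun k => incr1 h (grid_cell u k))).
exact/esym/telescope_sumr.
Qed.

End Grids.

(** * Common refinements *)

Section Refinement.
Variable R : realType.
Implicit Types (x y : \bar R) (I J : bnd1 R).

Lemma subitv_not_apart I J K : (K.1 < K.2)%E -> subitv K I -> subitv K J ->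
  ~ apart I J.
Proof.
move=> K0 /andP[I1 I2] /andP[J1 J2]; rewrite /apart => IJ.
suff : (K.2 <= K.1)%E by rewrite leNgt K0.
by apply: le_trans (le_trans IJ _); rewrite ?le_min ?ge_max ?I2 ?I1.
Qed.

(** An interval whose ends are grid points cannot cut a grid cell, hence
    contains each cell of which it contains an interior point. *)
Lemma subitv_grid_cell m u k I z : grid m u -> on_grid m u I -> (k < m)%N ->
  (u k < z < u k.+1)%E -> cell1 I z -> subitv (grid_cell u k) I.
Proof.
case: I => a b gu [[p pm] /= pa [q qm] qb] km /andP[kz zk] /andP[/= az zb].
subst a b; rewrite /subitv/= !(grid_leE gu)//; last exact: ltnW.
apply/andP; split; rewrite leqNgt; apply/negP => kp.
  have : (u k.+1 <= u p)%E by rewrite (grid_leE gu).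
  by move=> /le_trans/(_ az); rewrite leNgt zk.
have : (u q <= u k)%E by rewrite (grid_leE gu)// ltnW.
by move=> /(le_trans zb); rewrite leNgt kz.
Qed.

(** Each cell of a grid through all the ends lies in exactly one tile: some tile
    contains an interior point of it, and two tiles that both contain it would
    overlap. *)
Lemma grid_refines1 (T : finType) (I : T -> bnd1 R) m u : grid m u ->
  tiling1 I -> (forall i, on_grid m u (I i)) ->
  exists a : 'I_m -> T,
    forall (k : 'I_m) i, subitv (grid_cell u k) (I i) = (a k == i).
Proof.
move=> gu [I0 Ic Ia] Iu.
have uS (k : 'I_m) : (u k < u k.+1)%E by case: gu => _ _; apply.
have /choice[a aP] : forall k : 'I_m, exists i, subitv (grid_cell u k) (I i).
  move=> k; have [z kz] := ereal_between (uS k).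
  by have [i Iz] := Ic z; exists i; apply: (subitv_grid_cell gu) kz Iz.
exists a => k i; apply/idP/eqP => [ki|<-//].
apply/eqP; apply: contraT => /Ia.
case/(subitv_not_apart (K := grid_cell u k)) => //.
exact: uS.
Qed.

Lemma grid_refines2 (T : finType) (I : T -> bnd2 R) m u p v :
  grid m u -> grid p v -> tiling2 I ->
  (forall i, on_grid m u (I i).1 /\ on_grid p v (I i).2) ->
  exists a : 'I_m * 'I_p -> T, forall (k : 'I_m * 'I_p) i,
    subitv (grid_cell u k.1) (I i).1 && subitv (grid_cell v k.2) (I i).2 =
    (a k == i).
Proof.
move=> gu gv [I0 Ic Ia] Iuv.
have uS (k : 'I_m) : (u k < u k.+1)%E by case: gu => _ _; apply.
have vS (k : 'I_p) : (v k < v k.+1)%E by case: gv => _ _; apply.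
have /choice[a aP] : forall k : 'I_m * 'I_p, exists i,
    subitv (grid_cell u k.1) (I i).1 && subitv (grid_cell v k.2) (I i).2.
  move=> k; have [z kz] := ereal_between (uS k.1).
  have [w kw] := ereal_between (vS k.2).
  have [i [Iz Iw]] := Ic (z, w); have [iu iv] := Iuv i.
  exists i; apply/andP; split; first exact: (subitv_grid_cell gu) kz Iz.
  exact: (subitv_grid_cell gv) kw Iw.
exists a => k i; apply/idP/eqP => [/andP[ki1 ki2]|<-//].
have /andP[ka1 ka2] := aP k.
apply/eqP; apply: contraT => /Ia[].
  by move/(subitv_not_apart (K := grid_cell u k.1) (uS _) ka1 ki1).
by move/(subitv_not_apart (K := grid_cell v k.2) (vS _) ka2 ki2).
Qed.

(** The planar increment is an iterated one, which reduces telescoping in the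
    plane to telescoping in each variable. *)
Lemma incr2E (g : \bar R * \bar R -> R) (I : bnd2 R) :
  incr2 g I = incr1 (fun x => incr1 (fun y => g (x, y)) I.2) I.1.
Proof. by rewrite /incr1 /incr2; ring. Qed.

Lemma incr1_sum m (f : 'I_m -> \bar R -> R) (P : pred 'I_m) I :
  incr1 (fun x => \sum_(k | P k) f k x) I = \sum_(k | P k) incr1 (f k) I.
Proof. by rewrite /incr1 -sumrB. Qed.

Lemma grid_telescope2 m u p v (I : bnd2 R) g : grid m u -> grid p v ->
  (I.1.1 < I.1.2)%E -> (I.2.1 < I.2.2)%E ->
  on_grid m u I.1 -> on_grid p v I.2 ->
  incr2 g I = \sum_(k : 'I_m * 'I_p |
    subitv (grid_cell u k.1) I.1 && subitv (grid_cell v k.2) I.2)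
      incr2 g (grid_cell u k.1, grid_cell v k.2).
Proof.
move=> gu gv I1 I2 uI vI.
rewrite incr2E (grid_telescope _ gu)//.
rewrite -(pair_big_dep (fun k : 'I_m => subitv (grid_cell u k) I.1)
  (fun _ (l : 'I_p) => subitv (grid_cell v l) I.2)
  (fun (k : 'I_m) (l : 'I_p) => incr2 g (grid_cell u k, grid_cell v l)))/=.
apply: eq_bigr => k _; under eq_bigr do rewrite incr2E/=.
rewrite -incr1_sum; congr incr1; apply/funext => x.
exact: grid_telescope.
Qed.

Lemma exists_grid_of (T T' : finType) (I : T -> bnd1 R) (J : T' -> bnd1 R) :
  exists m u, [/\ grid m u, forall i, on_grid m u (I i) &
    forall j, on_grid m u (J j)].
Proof.
pose ends (S : finType) (K : S -> bnd1 R) :=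
  [seq (K i).1 | i <- enum S] ++ [seq (K i).2 | i <- enum S].
have [m [u [gu uP]]] := exists_grid (ends _ I ++ ends _ J).
exists m, u; split=> // i; split; apply: uP; rewrite !mem_cat.
- by rewrite (map_f (fun i => (I i).1)) ?mem_enum.
- by rewrite (map_f (fun i => (I i).2)) ?mem_enum ?orbT.
- by rewrite (map_f (fun i => (J i).1)) ?mem_enum ?orbT.
- by rewrite (map_f (fun i => (J i).2)) ?mem_enum ?orbT.
Qed.

Lemma subitv_left u k I : (u k < u k.+1)%E -> subitv (grid_cell u k) I ->
  cell1 I (u k).
Proof.
move=> uk /andP[/= Iu uI]; rewrite /cell1/= Iu/=.
exact: le_trans (ltW uk) uI.
Qed.

Lemma refinement1 n (I : 'I_n -> bnd1 R) m (J : 'I_m -> bnd1 R) :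
  division1 I -> division1 J ->
  exists p (K : 'I_p -> bnd1 R) (a : 'I_p -> 'I_n) (b : 'I_p -> 'I_m),
  [/\ division1 K,
      forall k, cell1 (I (a k)) `&` cell1 (J (b k)) !=set0,
      forall g i, incr1 g (I i) = \sum_(k | a k == i) incr1 g (K k) &
      forall g j, incr1 g (J j) = \sum_(k | b k == j) incr1 g (K k)].
Proof.
move=> /division1P dI /division1P dJ.
have [p [u [gu Iu Ju]]] := exists_grid_of I J.
have [a aP] := grid_refines1 gu dI Iu.
have [b bP] := grid_refines1 gu dJ Ju.
have uS (k : 'I_p) : (u k < u k.+1)%E by case: gu => _ _; apply.
exists p, (fun k : 'I_p => grid_cell u k), a, b; split.
- exact/division1P/grid_tiling.
- move=> k; exists (u k).
  by split; apply: subitv_left => //; rewrite ?aP ?bP eqxx.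
- move=> g i; rewrite (grid_telescope _ gu)//; last by case: dI.
  by apply: eq_bigl => k; rewrite aP.
- move=> g j; rewrite (grid_telescope _ gu)//; last by case: dJ.
  by apply: eq_bigl => k; rewrite bP.
Qed.

Lemma grid_tiling2 m u p v : grid m u -> grid p v ->
  tiling2 (fun k : 'I_m * 'I_p => (grid_cell u k.1, grid_cell v k.2) : bnd2 R).
Proof.
move=> gu gv; have [u0 uc ua] := grid_tiling gu.
have [v0 vc va] := grid_tiling gv.
split=> [k|[x y]|k l].
- by split; [exact: u0|exact: v0].
- by have [k kx] := uc x; have [l ly] := vc y; exists (k, l).
- rewrite -pair_eqE negb_and => /orP[kl|kl]; first by left; exact: ua.
  by right; exact: va.
Qed.

Lemma sum_enum_val (T : finType) (P : pred T) (f : T -> R) :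
  \sum_(k | P k) f k = \sum_(k < #|T| | P (enum_val k)) f (enum_val k).
Proof.
rewrite (reindex (@enum_val T predT)) //.
by apply: onW_bij; exact: enum_val_bij.
Qed.

Lemma refinement2 n (I : 'I_n -> bnd2 R) m (J : 'I_m -> bnd2 R) :
  division2 I -> division2 J ->
  exists p (K : 'I_p -> bnd2 R) (a : 'I_p -> 'I_n) (b : 'I_p -> 'I_m),
  [/\ division2 K,
      forall k, cell2 (I (a k)) `&` cell2 (J (b k)) !=set0,
      forall g i, incr2 g (I i) = \sum_(k | a k == i) incr2 g (K k) &
      forall g j, incr2 g (J j) = \sum_(k | b k == j) incr2 g (K k)].
Proof.
move=> /division2P dI /division2P dJ.
have [p [u [gu Iu Ju]]] := exists_grid_of (fun i => (I i).1) (fun i => (J i).1).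
have [q [v [gv Iv Jv]]] := exists_grid_of (fun i => (I i).2) (fun i => (J i).2).
have [a aP] := grid_refines2 gu gv dI (fun i => conj (Iu i) (Iv i)).
have [b bP] := grid_refines2 gu gv dJ (fun i => conj (Ju i) (Jv i)).
have uS (k : 'I_p) : (u k < u k.+1)%E by case: gu => _ _; apply.
have vS (k : 'I_q) : (v k < v k.+1)%E by case: gv => _ _; apply.
pose K (k : 'I_p * 'I_q) : bnd2 R := (grid_cell u k.1, grid_cell v k.2).
exists #|{: 'I_p * 'I_q}|, (K \o @enum_val _ predT), (a \o @enum_val _ predT),
  (b \o @enum_val _ predT); split.
- exact/tiling2_division/grid_tiling2.
- move=> k0 /=; set k := enum_val k0; exists (u k.1, v k.2).
  have /andP[? ?] : subitv (grid_cell u k.1) (I (a k)).1 &&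
      subitv (grid_cell v k.2) (I (a k)).2 by rewrite aP.
  have /andP[? ?] : subitv (grid_cell u k.1) (J (b k)).1 &&
      subitv (grid_cell v k.2) (J (b k)).2 by rewrite bP.
  by split; split; apply: subitv_left.
- move=> g i; have [/(_ i)[I1 I2] _ _] := dI.
  rewrite (grid_telescope2 _ gu gv)//.
  by rewrite (eq_bigl (fun k => a k == i)) ?(sum_enum_val (fun k => a k == i)).
- move=> g i; have [/(_ i)[J1 J2] _ _] := dJ.
  rewrite (grid_telescope2 _ gu gv)//.
  by rewrite (eq_bigl (fun k => b k == i)) ?(sum_enum_val (fun k => b k == i)).
Qed.
End Refinement.

(** * Cousin's lemma *)

Section Cousin.
Variable R : realType.
Implicit Types (x y : \bar R) (N : \bar R -> set (\bar R)).

Lemma nbhs_left x (A : set (\bar R)) : nbhs x A ->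
  x = -oo%E \/ exists2 a, (a < x)%E & forall y, (a < y <= x)%E -> A y.
Proof.
case: x => [r||]; last by left.
  move=> /(@nbhs_ballP _ _ r)[e /= e0 rA]; right; exists (r - e)%:E.
    by rewrite lte_fin; lra.
  case=> [s||]; rewrite ?leeNy_eq ?leye_eq ?andbF//.
  rewrite lte_fin lee_fin => /andP[? ?]; apply: rA.
  by rewrite -ball_normE /= ltr_norml; apply/andP; split; lra.
move=> [M [_ MA]]; right; exists M%:E; first exact: ltry.
by move=> y /andP[/MA].
Qed.

Lemma nbhs_right x (A : set (\bar R)) : nbhs x A ->
  x = +oo%E \/ exists2 b, (x < b)%E & forall y, (x <= y <= b)%E -> A y.
Proof.
case: x => [r||]; [|by left|].
  move=> /(@nbhs_ballP _ _ r)[e /= e0 rA]; right; exists (r + e / 2)%:E.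
    by rewrite lte_fin; lra.
  case=> [s||]; rewrite ?leeNy_eq ?leye_eq ?andbF//.
  rewrite !lee_fin => /andP[? ?]; apply: rA.
  by rewrite -ball_normE /= ltr_norml; apply/andP; split; lra.
move=> [M [_ MA]]; right; exists (M - 1)%:E; first exact: ltNyr.
move=> y /andP[_ yM]; apply: MA; apply: le_lt_trans yM _.
by rewrite lte_fin; lra.
Qed.

(** A fine tagged division of the interval from the lower infinity to [u m], as
    a chain of [m] consecutive cells. *)
Definition tagged_path N m (u t : nat -> \bar R) : Prop :=
  u 0%N = -oo%E /\ forall k, (k < m)%N ->
  [/\ (u k < u k.+1)%E, cell1 (grid_cell u k) (t k) &
      cell1 (grid_cell u k) `<=` N (t k)].

Definition reachable N x : Prop :=
  exists m u t, tagged_path N m u t /\ u m = x.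

Lemma reachable_step N x y s : reachable N x -> (x < y)%E ->
  cell1 (x, y) s -> cell1 (x, y) `<=` N s -> reachable N y.
Proof.
move=> [m [u [t [[u0 ut] um]]]] xy xys xyN.
exists m.+1, (fun k => if (k <= m)%N then u k else y),
  (fun k => if (k < m)%N then t k else s); split; last by rewrite /= ltnn.
split=> // k; rewrite ltnS leq_eqVlt /grid_cell => /predU1P[->|km].
  by rewrite leqnn !ltnn um eqxx.
by rewrite (ltnW km) km orbT; exact: ut.
Qed.

(** Cousin's lemma on the extended line.  The supremum [c] of the reachable
    points is itself reachable: if it is not yet reached, add one cell tagged at
    [c].  And it is the upper infinity, as otherwise another cell tagged at [c]
    would go beyond it. *)
Lemma cousin_path N : (forall x, nbhs x (N x)) ->
  exists m u t, grid m u /\ tagged_path N m u t.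
Proof.
move=> Nx; pose c := ereal_sup [set x | reachable N x].
have c_reach : reachable N c.
  have [cN|[a ac acN]] := nbhs_left (Nx c).
    by rewrite cN; exists 0%N, (cst -oo%E), (cst -oo%E).
  have [x xr ax] := ereal_sup_gt ac.
  have : (x <= c)%E by exact: ereal_sup_ubound.
  rewrite le_eqVlt => /predU1P[<-//|xc].
  apply: (reachable_step (s := c) xr xc); first by rewrite /cell1/= lexx ltW.
  move=> y /andP[/= xy yc]; apply: acN.
  by rewrite yc andbT (lt_le_trans ax).
have [cy|[b cb cbN]] := nbhs_right (Nx c).
  case: c_reach => m [u [t [ut um]]]; exists m, u, t; split=> //.
  split; [by case: ut|by rewrite um|].
  by move=> k km; case: ut => _ /(_ k km)[].
have : (b <= c)%E.
  apply: ereal_sup_ubound; apply: (reachable_step (s := c) c_reach cb) => //.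
  by rewrite /cell1/= lexx ltW.
by rewrite leNgt cb.
Qed.

Lemma cousin1 N : (forall x, nbhs x (N x)) ->
  exists n (I : 'I_n -> bnd1 R) (t : 'I_n -> \bar R),
    gauge_fine (@cell1 R) (@division1 R) N I t.
Proof.
move=> /cousin_path[m [u [t [gu [_ ut]]]]].
exists m, (fun k : 'I_m => grid_cell u k), t; split.
- exact/division1P/grid_tiling.
- by move=> k; have [] := ut k (ltn_ord k).
- by move=> k; have [] := ut k (ltn_ord k).
Qed.

(** A one-dimensional fine division of the vertical line through [x], all of
    whose tags lie on that line, is finite; hence its cells can be thickened to
    rectangles over a common neighbourhood [U] of [x]. *)
Lemma cousin_strip (N : \bar R * \bar R -> set (\bar R * \bar R)) x :
  (forall z, nbhs z (N z)) ->
  exists m (v t : nat -> \bar R) (U : set (\bar R)),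
  [/\ grid m v, nbhs x U, forall j : 'I_m, cell1 (grid_cell v j) (t j) &
      forall j : 'I_m, U `*` cell1 (grid_cell v j) `<=` N (x, t j)].
Proof.
move=> Nz.
have /choice[P PN] : forall y, exists P : set (\bar R) * set (\bar R),
    (nbhs x P.1 /\ nbhs y P.2) /\ P.1 `*` P.2 `<=` N (x, y).
  by move=> y; have [P ? ?] := Nz (x, y); exists P.
have [|m [v [t [gv [_ vt]]]]] := @cousin_path (fun y => (P y).2).
  by move=> y; case: (PN y) => -[].
exists m, v, t, [set x' | forall j : 'I_m, (P (t j)).1 x']; split=> //.
- by apply: filter_forall => j; case: (PN (t j)) => -[].
- by move=> j; have [] := vt j (ltn_ord j).
- move=> j [x' y] [/= Px' vy]; have [_ _ vN] := vt j (ltn_ord j).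
  by have [_] := PN (t j); apply; split=> //=; exact: vN.
Qed.

(** Cousin's lemma in the plane from the one on the line: the neighbourhoods
    given by the strips have a fine division, and above each of its cells the
    strip of its tag is cut into rectangles.  These need not form a grid, as the
    cuts vary from one strip to the next. *)
Lemma cousin2 (N : \bar R * \bar R -> set (\bar R * \bar R)) :
  (forall z, nbhs z (N z)) ->
  exists n (I : 'I_n -> bnd2 R) (t : 'I_n -> \bar R * \bar R),
    gauge_fine (@cell2 R) (@division2 R) N I t.
Proof.
move=> Nz; have strip x := cousin_strip x Nz.
have /choice[m /choice[v /choice[t /choice[U vtU]]]] := strip.
have [|p [u [s [gu [_ us]]]]] := @cousin_path U.
  by move=> x; case: (vtU x).
pose T := {i : 'I_p & 'I_(m (s i))}.
pose K (k : T) : bnd2 R :=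
  (grid_cell u (tag k), grid_cell (v (s (tag k))) (tagged k)).
pose tK (k : T) := (s (tag k), t (s (tag k)) (tagged k)).
have KN k : cell2 (K k) (tK k) /\ cell2 (K k) `<=` N (tK k).
  case: k => i j; have [_ _ vt vN] := vtU (s i).
  have [_ uts uU] := us i (ltn_ord i).
  split; first by split=> //=; exact: vt.
  by move=> [x y] [/= ux vy]; apply: vN; split=> //=; exact: uU.
have tK2 : tiling2 K.
  have [u0 uc ua] := grid_tiling gu.
  have vtil i := grid_tiling (let: And4 gv _ _ _ := vtU (s i) in gv).
  split.
  - by move=> [i j]; split; [exact: u0|case: (vtil i) => + _ _; exact].
  - move=> [x y]; have [i ix] := uc x.
    have [_ /(_ y)[j jy] _] := vtil i.
    by exists (existT _ i j).
  - move=> [i j] [i' j'] ij; have [ii'|ii'] := eqVneq i i'; last first.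
      by left; exact: ua.
    subst i'; right; have [_ _] := vtil i; apply.
    by apply: contra_neq ij => /= ->.
exists #|{: T}|, (K \o @enum_val _ predT), (tK \o @enum_val _ predT); split.
- exact: tiling2_division.
- by move=> k; case: (KN (enum_val k)).
- by move=> k; case: (KN (enum_val k)).
Qed.

End Cousin.

(** * Convergence of Henstock-Stieltjes integrals *)

Section Convergence.
Variable R : realType.
Implicit Types (x y : \bar R) (N : \bar R -> set (\bar R)).

Lemma open_finite : open (range (@EFin R)).
Proof.
rewrite (_ : range _ = [set x | -oo < x]%E `&` [set x | x < +oo]%E).
  apply: openI; [exact: open_ereal_gt_ereal|exact: open_ereal_lt_ereal].
apply/seteqP; split=> [_ [r _ <-]|[r||] []]//=; first by rewrite ltNyr ltry.
by move=> _ _; exists r.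
Qed.

Lemma gauge1_nbhs (gam : \bar R -> set (\bar R)) : gauge1 gam ->
  forall x, nbhs x (gam x).
Proof. by move=> [go _] x; have [? ?] := go x; exact: open_nbhs_nbhs. Qed.

Lemma gauge2_nbhs (gam : \bar R * \bar R -> set (\bar R * \bar R)) :
  gauge2 gam -> forall z, nbhs z (gam z).
Proof. by move=> [go _] x; have [? ?] := go x; exact: open_nbhs_nbhs. Qed.

(** Near a finite point a gauge may contain finite points only, so there the
    neighbourhood is intersected with the open set of finite points. *)
Lemma gauge1_shrink N : (forall x, nbhs x (N x)) ->
  exists gam, gauge1 gam /\ forall x, gam x `<=` N x.
Proof.
move=> Nx.
exists (fun x => interior (N x) `&`
  if x is _%:E then range (@EFin R) else setT).
split; last by move=> x y [/interior_subset].
split=> [x|x y []//]; split.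
- apply: openI; first exact: open_interior.
  by case: x => [r||]; [exact: open_finite|exact: openT|exact: openT].
- by split; [exact: Nx|case: x].
Qed.

Lemma gauge2_shrink (N : \bar R * \bar R -> set (\bar R * \bar R)) :
  (forall z, nbhs z (N z)) ->
  exists gam, gauge2 gam /\ forall z, gam z `<=` N z.
Proof.
move=> Nz.
exists (fun z => interior (N z) `&`
  if z is (_%:E, _%:E) then range (@emb2 R) else setT).
split; last by move=> x y [/interior_subset].
split=> [z|z y []//]; split.
- apply: openI; first exact: open_interior.
  case: z => [[r||] [s||]]; try exact: openT.
  rewrite (_ : range _ =
      fst @^-1` range (@EFin R) `&` snd @^-1` range (@EFin R)).
    apply: openI.
      by apply: open_comp open_finite => z _; exact: cvg_fst.
    by apply: open_comp open_finite => z _; exact: cvg_snd.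
  apply/seteqP; split=> [_ [w _ <-]|[x y] [[a _ /= <-] [b _ /= <-]]].
    by split; [exists w.1|exists w.2].
  by exists (a, b).
- by split; [exact: Nz|case: z => [[r||] [s||]]//=; exists (r, s)].
Qed.

Lemma incr1_cvg (gn : nat -> \bar R -> R) g I :
  (forall x, (fun n => gn n x) @ \oo --> g x) ->
  (fun n => incr1 (gn n) I) @ \oo --> incr1 g I.
Proof. by move=> gng; apply: cvgB. Qed.

Lemma incr2_cvg (gn : nat -> \bar R * \bar R -> R) g I :
  (forall z, (fun n => gn n z) @ \oo --> g z) ->
  (fun n => incr2 (gn n) I) @ \oo --> incr2 g I.
Proof. by move=> gng; apply: cvgB => //; apply: cvgB => //; apply: cvgD. Qed.

Lemma variation1_lsc (hn : nat -> \bar R -> R) h (M : R) :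
  (forall x, (fun n => hn n x) @ \oo --> h x) ->
  (forall n, (variation1 (hn n) <= M%:E)%E) -> (variation1 h <= M%:E)%E.
Proof. exact: (box_variation_lsc (division := @division1 R) incr1_cvg). Qed.

Lemma V12_lsc (gn : nat -> \bar R * \bar R -> R) g (M : R) :
  (forall z, (fun n => gn n z) @ \oo --> g z) ->
  (forall n, (V12 (gn n) <= M%:E)%E) -> (V12 g <= M%:E)%E.
Proof. exact: (box_variation_lsc (division := @division2 R) incr2_cvg). Qed.

Lemma HSint1_cvg F (hn : nat -> \bar R -> R) h (M : R) : continuous F ->
  (forall n, (variation1 (hn n) <= M%:E)%E) ->
  (forall x, (fun n => hn n x) @ \oo --> h x) ->
  (fun n => HSint1 F (hn n)) @ \oo --> HSint1 F h.
Proof.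
exact: (stieltjes_cvg gauge1_nbhs gauge1_shrink (@cousin1 R) (@refinement1 R)
  incr1_cvg).
Qed.

Lemma HSint2_cvg F (gn : nat -> \bar R * \bar R -> R) g (M : R) :
  continuous F -> (forall n, (V12 (gn n) <= M%:E)%E) ->
  (forall z, (fun n => gn n z) @ \oo --> g z) ->
  (fun n => HSint2 F (gn n)) @ \oo --> HSint2 F g.
Proof.
exact: (stieltjes_cvg gauge2_nbhs gauge2_shrink (@cousin2 R) (@refinement2 R)
  incr2_cvg).
Qed.

(** A supremum over the empty set would be the lower infinity, so the existence
    of a division is needed. *)
Lemma variation1_ge0 (h : \bar R -> R) : (0 <= variation1 h)%E.
Proof.
have [n [I [t [dI _ _]]]] := cousin1 (fun x => filterT : nbhs x setT).
apply: (@le_trans _ _ (\sum_(i < n) `|incr1 h (I i)|)%:E).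
  by rewrite lee_fin sumr_ge0.
by apply: ereal_sup_ubound; exists n, I.
Qed.

Lemma V12_ge0 (g : \bar R * \bar R -> R) : (0 <= V12 g)%E.
Proof.
have [n [I [t [dI _ _]]]] :=
  cousin2 (fun z : \bar R * \bar R => filterT : nbhs z setT).
apply: (@le_trans _ _ (\sum_(i < n) `|incr2 g (I i)|)%:E).
  by rewrite lee_fin sumr_ge0.
by apply: ereal_sup_ubound; exists n, I.
Qed.

Lemma bvnorm_ge (g : \bar R * \bar R -> R) x y :
  [/\ (V1 g y <= bvnorm g)%E, (V2 g x <= bvnorm g)%E & (V12 g <= bvnorm g)%E].
Proof.
have sup_ge (T : Type) (f : T -> \bar R) i : (f i <= ereal_sup (range f))%E.
  by apply: ereal_sup_ubound; exists i.
have g0 : (0 <= ereal_sup (range (fun z => `|g z|%R%:E)))%E.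
  by apply: le_trans (sup_ge _ _ (0%E, 0%E)); rewrite lee_fin.
have V1y := sup_ge _ (V1 g) y; have V2x := sup_ge _ (V2 g) x.
have V10 := le_trans (variation1_ge0 _) V1y.
have V20 := le_trans (variation1_ge0 _) V2x.
have V120 := V12_ge0 g.
rewrite /bvnorm; split.
- apply: (le_trans V1y); apply: le_trans (leeDr _ g0) _.
  by rewrite -addeA leeDl// adde_ge0.
- apply: (le_trans V2x); apply: le_trans (leeDl _ V120).
  by rewrite leeDr// adde_ge0.
- by rewrite leeDr// !adde_ge0.
Qed.

Lemma continuous_section (F : \bar R * \bar R -> R) x : continuous F ->
  continuous (fun s => F (s, x)) /\ continuous (fun t => F (x, t)).
Proof.
move=> Fc; split=> y; apply: continuous_comp (Fc _).
  by apply: cvg_pair; [exact: cvg_id|exact: cvg_cst].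
by apply: cvg_pair; [exact: cvg_cst|exact: cvg_id].
Qed.

Lemma primitive_continuous (f : schwartz_distribution R) :
  Ac f -> continuous (primitive f).
Proof. by move=> /(@xgetPex _ (cst 0))[[]]. Qed.

End Convergence.

(** * Convergence of the integrals of the products *)

Theorem proposition9p1 (R : realType) (f : schwartz_distribution R)
    (gn : nat -> \bar R * \bar R -> R) (g : \bar R * \bar R -> R) :
  Ac f ->
  (forall n, HKBV (gn n)) ->
  (exists M : R, forall n, (bvnorm (gn n) <= M%:E)%E) ->
  (forall z, (fun n => gn n z) @ \oo --> g z) ->
  HKBV g /\
  (fun n => int_prod f (gn n)) @ \oo --> int_prod f g.
Proof.
move=> /primitive_continuous Fc _ [M gnM] gng.
have V1M n : (V1 (gn n) +oo <= M%:E)%E.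
  by apply: le_trans (gnM n); case: (bvnorm_ge (gn n) +oo%E +oo%E).
have V2M n : (V2 (gn n) +oo <= M%:E)%E.
  by apply: le_trans (gnM n); case: (bvnorm_ge (gn n) +oo%E +oo%E).
have V12M n : (V12 (gn n) <= M%:E)%E.
  by apply: le_trans (gnM n); case: (bvnorm_ge (gn n) +oo%E +oo%E).
split.
  split; first exact: le_lt_trans (V12_lsc gng V12M) (ltry M).
  exists +oo%E, +oo%E; split.
    by apply: le_lt_trans (ltry M); apply: variation1_lsc V1M.
  by apply: le_lt_trans (ltry M); apply: variation1_lsc V2M.
have [Fc1 Fc2] := continuous_section +oo%E Fc.
apply: cvgD; last exact: HSint2_cvg V12M gng.
apply: cvgB; last by apply: HSint1_cvg V2M _.
apply: cvgB; last by apply: HSint1_cvg V1M _.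
by apply: cvgM; [exact: cvg_cst|exact: gng].
Qed.
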